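(* Let $p>1$, let $q$ be defined by $1/p+1/q=1$, and put $r:=\min\{p,2\}$. Let $(\xi_n)_{n\ge 0}$ be a martingale (with respect to its natural filtration $\mathcal{F}_n=\sigma(\xi_0,\dots,\xi_n)$) on a probability space $(\Omega,\mathcal{F},\mathbb{P})$ such that $\xi_0\in Sub_{\varphi_p}(\Omega)$ with $\tau_{\varphi_p}(\xi_0)\le d_0$ for a real number $d_0\ge 0$, and such that its increments are bounded: $|\xi_n-\xi_{n-1}|\le d_n$ almost surely for $n=1,2,\dots$, where $d_n\ge 0$ are real numbers. Fix $n\ge 1$ such that $d_1,\dots,d_n$ are not all zero, and set $$c=\sqrt{\sum_{i=1}^n d_i^2},\qquad d=\sum_{i=1}^n d_i,\qquad \gamma_r=\frac{c^2}{2d}\Big\{r\Big[2\Big(\frac{d}{c}\Big)^2+\frac1r-\frac12\Big]\Big\}^{1/r}.$$ Then for every $\varepsilon>0$ $$\mathbb{P}(|\xi_n|\ge\varepsilon)\le 2\exp\left(-\varphi_q\left(\frac{\varepsilon}{\sqrt[r]{\gamma_r^r+d_0^r}}\right)\right).$$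
   Context: For $s>1$ the function $\varphi_s:\mathbb{R}\to[0,\infty)$ is defined by $\varphi_s(x)=\frac{x^2}{2}$ if $|x|\le 1$ and $\varphi_s(x)=\frac1s|x|^s-\frac1s+\frac12$ if $|x|>1$. For a real random variable $\xi$ on $(\Omega,\mathcal{F},\mathbb{P})$ define $$\tau_{\varphi_s}(\xi)=\inf\{c\ge 0:\ \forall \lambda\in\mathbb{R},\ \ln\mathbb{E}\exp(\lambda\xi)\le\varphi_s(c\lambda)\}$$ (with $\inf\emptyset=\infty$), and $Sub_{\varphi_s}(\Omega)=\{\xi:\ \tau_{\varphi_s}(\xi)<\infty\}$. Elements of $Sub_{\varphi_s}(\Omega)$ are called subgaussian of rank $s$ random variables. *)

(* Defs.v *)
From HB Require Import structures.
From mathcomp Require Import all_boot all_order all_algebra.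
From mathcomp Require Import all_classical all_reals all_analysis.

Set Implicit Arguments.
Unset Strict Implicit.
Unset Printing Implicit Defensive.

Import Order.TTheory GRing.Theory Num.Theory.
Import numFieldNormedType.Exports.

Local Open Scope classical_set_scope.
Local Open Scope ring_scope.

Definition phi (R : realType) (s x : R) : R :=
  if `|x| <= 1 then x ^+ 2 / 2
  else s^-1 * `|x| `^ s - s^-1 + 2^-1.

(* The exponential moment may be infinite, so the inequality is stated in
   \bar R, where lne +oo = +oo; ereal_inf set0 = +oo. *)
Definition tau (d : measure_display) (T : measurableType d) (R : realType)
    (P : probability T R) (s : R) (X : {RV P >-> R}) : \bar R :=
  ereal_inf [set c%:E | c in [set c : R | 0 <= c /\
    forall l : R, (lne 'E_P[fun w => expR (l * X w)] <= (phi s (c * l))%:E)%E]].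

Definition Sub_phi (d : measure_display) (T : measurableType d) (R : realType)
    (P : probability T R) (s : R) : set {RV P >-> R} :=
  [set X : {RV P >-> R} | (tau s X < +oo)%E].

Definition filtration (d : measure_display) (T : measurableType d)
    (F : nat -> set (set T)) : Prop :=
  [/\ forall n, sigma_algebra setT (F n),
      forall n, F n `<=` measurable
    & forall m n, (m <= n)%N -> F m `<=` F n].

Definition natural_filtration (d : measure_display) (T : measurableType d)
    (R : realType) (X : nat -> T -> R) (n : nat) : set (set T) :=
  <<s \bigcup_(i in [set i | (i <= n)%N])
        preimage_set_system setT (X i) measurable >>.

(* Y is a version of the conditional expectation E[X | G]. *)
Definition is_cond_exp (d : measure_display) (T : measurableType d)
    (R : realType) (P : probability T R) (G : set (set T))
    (X Y : T -> R) : Prop :=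
  [/\ preimage_set_system setT Y measurable `<=` G,
      P.-integrable setT (EFin \o Y)
    & forall A, G A ->
        (\int[P]_(w in A) (Y w)%:E = \int[P]_(w in A) (X w)%:E)%E].

(* As X n is required to be F n-measurable, "E[X (n+1) | F n] = X n a.s."
   says that X n itself is a version of that conditional expectation. *)
Definition martingale (d : measure_display) (T : measurableType d)
    (R : realType) (P : probability T R) (F : nat -> set (set T))
    (X : nat -> {RV P >-> R}) : Prop :=
  [/\ filtration F,
      forall n, preimage_set_system setT (X n) measurable `<=` F n,
      forall n, P.-integrable setT (EFin \o X n)
    & forall n, is_cond_exp P (F n) (X n.+1) (X n)].

(* Main.v *)
(** Conditionally on the past, Hoeffding's lemma and the trivial bound on the
    increments give, with [c] and [d] as in the theorem,
    E exp(l (xi_n - xi_0)) <= exp(min(c^2 l^2 / 2, d |l|)).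
    Since phi_r(x) / x^2 is nonincreasing and phi_r(x) / x^r nondecreasing for
    r <= 2, this minimum is at most phi_r(gamma_r l): gamma_r is the constant for
    which the two sides agree at the crossing point |l| = 2 d / c^2.
    As phi_p(x) / x^r is nondecreasing for r = min(p, 2), the function
    t |-> phi_p(t^(1/r)) is superadditive, whence
    phi_p(d_0 l) + phi_r(gamma_r l) <= phi_p((gamma_r^r + d_0^r)^(1/r) l).
    The tail bound is then Chernoff's, phi_q being the convex conjugate of phi_p. *)
Require Import Defs.
From HB Require Import structures.
From mathcomp Require Import all_boot all_order all_algebra.
From mathcomp Require Import all_classical all_reals all_analysis.
From mathcomp Require Import finmap measurable_realfun ring lra.

Import Order.TTheory GRing.Theory Num.Theory.
Import numFieldNormedType.Exports.

Local Open Scope classical_set_scope.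
Local Open Scope ring_scope.

(** * Scaling, superadditivity and duality of [phi] *)

Section phi_theory.
Context {R : realType}.
Implicit Types a b c d g l p q s r x y rho : R.

Lemma phi_le1 s x : `|x| <= 1 -> phi s x = x ^+ 2 / 2.
Proof. by rewrite /phi => ->. Qed.

Lemma phi_ge1 s x : s != 0 -> 1 <= x -> phi s x = s^-1 * x `^ s - s^-1 + 2^-1.
Proof.
move=> s0 x1; rewrite /phi ger0_norm ?(le_trans ler01)//.
by case: ifPn => // x1'; have -> : x = 1 by [lra]; rewrite powR1; field.
Qed.

Lemma phi_norm s x : phi s `|x| = phi s x.
Proof. by rewrite /phi normr_id real_normK ?num_real. Qed.

Lemma phi0 s : phi s 0 = 0.
Proof. by rewrite phi_le1 ?normr0// expr0n/= mul0r. Qed.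

(** Bernoulli's inequality, read off from Young's inequality with second factor 1 and conjugate
    exponents [a] and [(1 - a^-1)^-1]; the exponent 1 has no finite conjugate and is treated
    apart. *)
Lemma powR_ge1BD a x : 1 <= a -> 0 <= x -> 1 + a * (x - 1) <= x `^ a.
Proof.
rewrite le_eqVlt => /predU1P[<- x0|a1 x0]; first by rewrite powRr1//; lra.
have b0 : 0 < 1 - a^-1 by rewrite subr_gt0 invf_lt1//; lra.
have := @conjugate_powR R x 1 a (1 - a^-1)^-1 x0 ler01.
rewrite invr_gt0 invrK powR1 mulr1 mul1r => /(_ _ b0 (subrKC _ _)) h.
have a0 : 0 < a by lra.
have := h a0; rewrite -(ler_pM2l a0) => {}h.
have e : a * (x `^ a / a + (1 - a^-1)) = x `^ a + (a - 1).
  by field; rewrite gt_eqF.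
by lra.
Qed.

(** The previous inequality with exponent [a^-1], taken at the [a]-th power of [x]. *)
Lemma powR_le1BD a x : 0 < a -> a <= 1 -> 0 <= x -> x `^ a <= 1 + a * (x - 1).
Proof.
move=> a0 a1 x0.
have := @powR_ge1BD a^-1 (x `^ a); rewrite invf_ge1// => /(_ a1 (powR_ge0 _ _)).
rewrite -powRrM divff ?gt_eqF// powRr1// -(ler_pM2l a0).
rewrite mulrDr mulrA divff ?gt_eqF//; lra.
Qed.

Lemma powR_half x s : 0 <= x -> (x ^+ 2) `^ (s / 2) = x `^ s.
Proof.
by move=> x0; rewrite -(powR_mulrn 2)// -powRrM mulrCA divff ?mulr1// pnatr_eq0.
Qed.

Lemma powRs_ge1 x s : 1 <= x -> 0 <= s -> 1 <= x `^ s.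
Proof. by move=> x1 s0; rewrite -(powRr0 x); exact: ler_powR. Qed.

(** For [s <= 2] the constant 1/2 - 1/s of the outer branch is nonpositive, so multiplying it by
    rho^s >= 1 only lowers it. The inner branch uses rho^s <= rho^2, and the case where [x] and
    [rho * x] lie on different sides of 1 uses x^2 <= x^s. *)
Lemma phi_ge_powR s rho x : 0 < s -> s <= 2 -> 1 <= rho -> 0 <= x ->
  rho `^ s * phi s x <= phi s (rho * x).
Proof.
move=> s0 s2 rho1 x0.
have rho0 : 0 <= rho by lra.
have s0' : s != 0 by rewrite gt_eqF.
have rs : rho `^ s <= rho ^+ 2 by rewrite -(powR_mulrn 2)// ler_powR.
have h1 : 2^-1 <= s^-1 by rewrite lef_pV2// posrE.
have rs1 := @powRs_ge1 rho s rho1 (ltW s0).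
have [x1|/ltW x1] := leP x 1; last first.
  rewrite !phi_ge1//; last nra.
  rewrite powRM//; have := powR_gt0 s (lt_le_trans ltr01 x1).
  have e : rho `^ s * (s^-1 * x `^ s - s^-1 + 2^-1) =
    s^-1 * (rho `^ s * x `^ s) - rho `^ s * (s^-1 - 2^-1) by ring.
  rewrite e; nra.
have [rx1|/ltW rx1] := leP (rho * x) 1.
  rewrite !phi_le1 ?ger0_norm ?mulr_ge0// exprMn.
  by rewrite mulrA ler_pM2r ?ler_wpM2r ?sqr_ge0// invr_gt0.
rewrite phi_le1 ?ger0_norm// phi_ge1// powRM//.
have xs : x ^+ 2 <= x `^ s.
  have [->|x0'] := eqVneq x 0; first by rewrite powR0// expr0n.
  by rewrite -(powR_mulrn 2)// ger_powR// lt0r x0' x0.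
have h2 : 1 <= rho `^ s * x `^ s by rewrite -powRM// powRs_ge1// ltW.
have h3 : rho `^ s * x ^+ 2 <= rho `^ s * x `^ s by rewrite ler_wpM2l// powR_ge0.
rewrite mulrA; nra.
Qed.

(** Beyond 1 this is Bernoulli's inequality for t^s = (t^2)^(s/2), whose exponent s/2 is at most
    1. *)
Lemma phi_le_sqr s rho x : 0 < s -> s <= 2 -> 1 <= rho -> 0 <= x ->
  phi s (rho * x) <= rho ^+ 2 * phi s x.
Proof.
move=> s0 s2 rho1 x0.
have s0' : s != 0 by rewrite gt_eqF.
have g t y : 1 <= t -> 1 <= y -> phi s (t * y) <= t ^+ 2 * phi s y.
  move=> t1 y1; rewrite !phi_ge1 ?powRM//; [|lra|lra|nra].
  have B : t `^ s <= 1 + (s / 2) * (t ^+ 2 - 1).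
    by rewrite -powR_half ?(le_trans ler01)// powR_le1BD ?sqr_ge0//; lra.
  have Y := @powRs_ge1 y s y1 (ltW s0).
  have T : t `^ s <= t ^+ 2 by rewrite -(powR_mulrn 2) ?ler_powR//; lra.
  rewrite -(ler_pM2l s0).
  have -> : s * (s^-1 * (t `^ s * y `^ s) - s^-1 + 2^-1) =
    t `^ s * y `^ s - 1 + s / 2 by field.
  have -> : s * (t ^+ 2 * (s^-1 * y `^ s - s^-1 + 2^-1)) =
    t ^+ 2 * y `^ s - t ^+ 2 + t ^+ 2 * (s / 2) by field.
  nra.
have [x1|/ltW x1] := leP x 1; last exact: g.
have [rx1|/ltW rx1] := leP (rho * x) 1.
  by rewrite !phi_le1 ?ger0_norm ?mulr_ge0// ?exprMn ?mulrA//; lra.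
(* When [rho * x] has crossed 1 but [x] has not, scale from 1 instead of [x]: up to 1 the function
   is exactly quadratic. *)
have := g (rho * x) 1 rx1 (lexx _); rewrite mulr1 => /le_trans; apply.
by rewrite !phi_le1 ?normr1 ?ger0_norm// exprMn expr1n; lra.
Qed.

(** Mirror image of [phi_le_sqr]: now s/2 >= 1, which reverses Bernoulli's inequality. *)
Lemma phi_ge_sqr s rho x : 2 <= s -> 1 <= rho -> 0 <= x ->
  rho ^+ 2 * phi s x <= phi s (rho * x).
Proof.
move=> s2 rho1 x0.
have s0 : 0 < s by lra.
have s0' : s != 0 by rewrite gt_eqF.
have g t y : 1 <= t -> 1 <= y -> t ^+ 2 * phi s y <= phi s (t * y).
  move=> t1 y1; rewrite !phi_ge1 ?powRM//; [|lra|lra|nra].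
  have B : 1 + (s / 2) * (t ^+ 2 - 1) <= t `^ s.
    by rewrite -powR_half ?(le_trans ler01)// powR_ge1BD ?sqr_ge0//; lra.
  have Y := @powRs_ge1 y s y1 (ltW s0).
  have T : t ^+ 2 <= t `^ s by rewrite -(powR_mulrn 2) ?ler_powR//; lra.
  rewrite -(ler_pM2l s0).
  have -> : s * (s^-1 * (t `^ s * y `^ s) - s^-1 + 2^-1) =
    t `^ s * y `^ s - 1 + s / 2 by field.
  have -> : s * (t ^+ 2 * (s^-1 * y `^ s - s^-1 + 2^-1)) =
    t ^+ 2 * y `^ s - t ^+ 2 + t ^+ 2 * (s / 2) by field.
  nra.
have [x1|/ltW x1] := leP x 1; last exact: g.
have [rx1|/ltW rx1] := leP (rho * x) 1.
  by rewrite !phi_le1 ?ger0_norm ?mulr_ge0// ?exprMn ?mulrA//; lra.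
have := g (rho * x) 1 rx1 (lexx _); rewrite mulr1 => /(le_trans _); apply.
by rewrite !phi_le1 ?normr1 ?ger0_norm// exprMn expr1n; lra.
Qed.

Lemma phi_ge_powR_min s rho x : 1 < s -> 1 <= rho -> 0 <= x ->
  rho `^ (Num.min s 2) * phi s x <= phi s (rho * x).
Proof.
move=> s1 rho1 x0; have [s2|/ltW s2] := leP s 2.
  by apply: phi_ge_powR => //; lra.
by rewrite (powR_mulrn 2) ?phi_ge_sqr//; lra.
Qed.

Lemma phi2E x : phi 2 x = x ^+ 2 / 2.
Proof.
rewrite /phi; case: ifPn => // _.
by rewrite (powR_mulrn 2)// real_normK ?num_real//; lra.
Qed.

Lemma phi2_le s x : 2 <= s -> phi 2 x <= phi s x.
Proof.
move=> s2; rewrite phi2E; have [x1|/ltW x1] := leP `|x| 1.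
  by rewrite phi_le1.
have := @phi_ge_sqr s `|x| 1 s2 x1 ler01.
by rewrite mulr1 phi_norm phi_le1 ?normr1// real_normK ?num_real// expr1n mulrA mulr1.
Qed.

(** The scaling hypothesis says that f(x)/x^r is nondecreasing. With m^r = a^r + b^r, both [a] and
    [b] are at most [m], so f(a) <= (a^r/m^r) f(m) and likewise for [b]; the two fractions add up to
    1. *)
Lemma superadditive_powR (f : R -> R) r a b : 0 < r -> f 0 = 0 ->
  (forall rho x, 1 <= rho -> 0 <= x -> rho `^ r * f x <= f (rho * x)) ->
  0 <= a -> 0 <= b -> f a + f b <= f ((a `^ r + b `^ r) `^ r^-1).
Proof.
move=> r0 f0 fr.
have rn0 : r != 0 by rewrite gt_eqF.
have [a0|an0] := eqVneq a 0.
  move=> _ b0; rewrite a0 powR0// f0 !add0r -powRrM divff// powRr1//.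
move=> a0 b0; set m := _ `^ r^-1.
have A : 0 < a `^ r by rewrite powR_gt0// lt0r an0.
have mr : m `^ r = a `^ r + b `^ r.
  by rewrite -powRrM mulVf// powRr1// addr_ge0// powR_ge0.
have m0 : 0 < m by rewrite powR_gt0// ltr_wpDr// powR_ge0.
(* The comparison of the ratios at [y] and [m], cross-multiplied so that [y = 0] is covered. *)
have h y : 0 <= y -> y `^ r <= m `^ r -> f y * m `^ r <= y `^ r * f m.
  move=> y0 ym; have [->|yn0] := eqVneq y 0; first by rewrite f0 powR0// !mul0r.
  have yp : 0 < y by rewrite lt0r yn0.
  have ylem : y <= m.
    rewrite leNgt; apply/negP => my; move: ym; apply/negP; rewrite -ltNge.
    by rewrite gt0_ltr_powR ?nnegrE ?(ltW m0).
  have := fr (m / y) y; rewrite divfK// ler_pdivlMr// mul1r => /(_ ylem y0).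
  rewrite powRM ?invr_ge0// ?(ltW m0)// -powR_inv1// -powRrM mulN1r powRN => h.
  have Y : 0 < y `^ r by rewrite powR_gt0.
  rewrite mulrC -ler_pdivrMl//; move: h; rewrite mulrA; congr (_ <= _).
  by congr (_ * _); rewrite mulrC.
have M : 0 < m `^ r by rewrite powR_gt0.
rewrite -(ler_pM2r M) mulrDl; apply: le_trans (lerD (h a a0 _) (h b b0 _)) _.
- by rewrite mr lerDl powR_ge0.
- by rewrite mr lerDr powR_ge0.
by rewrite -mulrDl -mr mulrC.
Qed.

Lemma phi_superadditive s a b : 1 < s -> 0 <= a -> 0 <= b ->
  phi s a + phi s b <=
  phi s ((a `^ Num.min s 2 + b `^ Num.min s 2) `^ (Num.min s 2)^-1).
Proof.
move=> s1; apply: superadditive_powR.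
- by rewrite lt_min; lra.
- exact: phi0.
- by move=> rho x; exact: phi_ge_powR_min.
Qed.

(* The two bounds cross at [l = 2 d / c], where both equal [2 d^2 / c]; they are
   compared with [phi r] on either side by [phi_le_sqr] and [phi_ge_powR]. *)
Lemma min_sqr_lin_le_phi r g c d l : 1 < r -> r <= 2 -> 0 < g -> 0 < c -> 0 < d ->
  phi r (g * (2 * d / c)) = 2 * d ^+ 2 / c ->
  0 <= l -> Num.min (c * l ^+ 2 / 2) (d * l) <= phi r (g * l).
Proof.
move=> r1 r2 g0 c0 d0 E l0; set l0' := 2 * d / c in E.
have L0 : 0 < l0' by rewrite divr_gt0// mulr_gt0.
have cn0 : c != 0 by rewrite gt_eqF.
have [ll|ll] := leP l0' l.
  have rho1 : 1 <= l / l0' by rewrite ler_pdivlMr// mul1r.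
  have gl : 0 <= g * l0' by rewrite mulr_ge0// ltW.
  have := @phi_ge_powR r (l / l0') (g * l0') _ r2 rho1 gl.
  have -> : l / l0' * (g * l0') = g * l by field; rewrite gt_eqF.
  rewrite E ge_min => h; apply/orP; right; apply: le_trans (h _); last lra.
  (* Past the crossing the linear bound grows by the factor rho = l / l0', and [phi r] by at least
     rho^r, which is no smaller as [r >= 1]. *)
  have -> : d * l = l / l0' * (2 * d ^+ 2 / c).
    by rewrite /l0'; field; rewrite cn0 gt_eqF.
  apply: ler_wpM2r; first by rewrite divr_ge0 ?(ltW c0)// mulr_ge0 ?sqr_ge0.
  by apply: le1r_powR => //; exact: ltW.
rewrite ge_min; apply/orP; left.
have [->|ln0] := eqVneq l 0.
  by rewrite mulr0 phi0 expr0n/= mulr0 mul0r.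
have lp : 0 < l by rewrite lt0r ln0.
have rho1 : 1 <= l0' / l by rewrite ler_pdivlMr// mul1r ltW.
have gl : 0 <= g * l by rewrite mulr_ge0// ltW.
have := @phi_le_sqr r (l0' / l) (g * l) _ r2 rho1 gl.
have -> : l0' / l * (g * l) = g * l0' by field.
rewrite E => h; have {}h := h (lt_trans ltr01 r1).
have R0 : 0 < (l0' / l) ^+ 2 by rewrite exprn_gt0// divr_gt0.
rewrite -(ler_pM2l R0); apply: le_trans h; rewrite le_eqVlt; apply/orP; left.
by apply/eqP; rewrite /l0'; field; rewrite cn0 gt_eqF.
Qed.

(** The conjugate is attained at the derivative of [phi q] at [x]: this is [x] up to 1 and x^(q-1)
    beyond. *)
Lemma phi_conj p q x : 1 < p -> p^-1 + q^-1 = 1 -> 0 < x ->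
  exists2 t, 0 < t & phi p t - t * x = - phi q x.
Proof.
move=> p1 pq x0.
have p0 : 0 < p by lra.
have Vp : p^-1 < 1 by rewrite invf_lt1.
have q0 : 0 < q by rewrite -invr_gt0; lra.
have q1 : 1 < q by rewrite -invf_lt1//; have : 0 < p^-1 by [rewrite invr_gt0]; lra.
have [x1|/ltW x1] := leP x 1.
  by exists x => //; rewrite !phi_le1 ?gtr0_norm//; lra.
exists (x `^ (q - 1)); first by rewrite powR_gt0.
rewrite !phi_ge1 ?gt_eqF//; last by rewrite powRs_ge1//; lra.
(* Hence the [p]-th power of the witness x^(q-1) is x^q. *)
have e : p = q / (q - 1).
  have -> : p = (1 - q^-1)^-1 by rewrite -pq addrK invrK.
  by field; rewrite !gt_eqF//; lra.
rewrite -powRrM [X in x `^ X](_ : _ = q); last first.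
  by rewrite e mulrC divfK// gt_eqF//; lra.
rewrite [_ * x]mulrC mulr_powRB1 ?ltW//.
have -> : p^-1 = 1 - q^-1 by rewrite -pq addrK.
by lra.
Qed.

(** A form without case distinction, from which monotonicity and continuity follow term by term. *)
Lemma phi_split s x : s != 0 ->
  phi s x = (Num.min `|x| 1) ^+ 2 / 2 + ((Num.max `|x| 1) `^ s - 1) / s.
Proof.
move=> s0; rewrite /phi; have [x1|x1] := leP `|x| 1.
  by rewrite powR1 real_normK ?num_real//; field.
by rewrite expr1n; field.
Qed.

Lemma phi_nondecreasing s x y : 0 < s -> `|x| <= `|y| -> phi s x <= phi s y.
Proof.
move=> s0 xy; rewrite !phi_split ?gt_eqF// lerD//.
  rewrite ler_pM2r ?invr_gt0// ler_pXn2r ?nnegrE ?le_min ?normr_ge0 ?ler01//.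
  by rewrite !ge_min xy lexx orbT.
rewrite ler_pM2r ?invr_gt0// lerD2r ge0_ler_powR ?(ltW s0)//.
- by rewrite nnegrE le_max ler01 orbT.
- by rewrite nnegrE le_max ler01 orbT.
by rewrite ge_max !le_max xy lexx orbT.
Qed.

Lemma continuous_phi s : 0 < s -> continuous (phi s).
Proof.
move=> s0 x.
have -> : phi s = fun x => (Num.min `|x| 1) ^+ 2 / 2 + ((Num.max `|x| 1) `^ s - 1) / s.
  by apply/funext => y; rewrite phi_split// gt_eqF.
have cn : {for x, continuous (fun y : R => `|y|)} by exact: norm_continuous.
have cm : {for x, continuous ((fun y : R => `|y|) \min cst 1)}.
  by apply: continuous_min => //; exact: cvg_cst.
have cM : {for x, continuous ((fun y : R => `|y|) \max cst 1)}.
  by apply: continuous_max => //; exact: cvg_cst.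
apply: cvgD; apply: cvgMr_tmp.
- exact: (@cvgM _ _ _ _ _ _ _ _ cm cm).
- apply: cvgB; last exact: cvg_cst.
  apply: (@continuous_comp _ _ _ (fun x : R => Num.max `|x| 1) (fun y : R => y `^ s)).
    exact: cM.
  (* The maximum with 1 keeps the base of the power positive, where the power is differentiable. *)
  have m0 : 0 < Num.max `|x| 1 by rewrite lt_max ltr01 orbT.
  apply/differentiable_continuous/derivable1_diffP/derivable_powR.
  by rewrite in_itv/= m0.
Qed.

End phi_theory.

(** * The affine majorant of the exponential in Hoeffding's lemma *)

Section exp_inequalities.
Context {R : realType}.
Implicit Types a x : R.

Lemma is_derive_le0_le (f df : R -> R) a :
  (forall x, is_derive x 1 f (df x)) -> (forall x, 0 <= x -> df x <= 0) ->
  0 <= a -> f a <= f 0.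
Proof.
move=> fdf df0 a0.
have [|c] := @MVT_segment R f df 0 a a0 (fun x _ => fdf x).
  by apply: derivable_within_continuous => x _; exact: (@ex_derive _ _ _ _ _ _ _ (fdf x)).
rewrite in_itv/= subr0 => /andP[c0 _] e; rewrite -subr_le0 e.
by rewrite mulr_le0_ge0// df0.
Qed.

(** The quotient [u] of the two sides, up to a factor 2, is nonincreasing: its derivative has the
    sign of [v] = 2 (sinh x - x cosh x), and [v] is nonpositive since it vanishes at 0 and has
    derivative -2 x sinh x. *)
Lemma cosh_le_expR_sqr a : 0 <= a -> expR a + expR (- a) <= 2 * expR (a ^+ 2 / 2).
Proof.
pose v x : R := (expR x - expR (- x)) - x * (expR x + expR (- x)).
have v0 x : 0 <= x -> v x <= 0.
  have dv (y : R) : is_derive y 1 v (- (y * (expR y - expR (- y)))).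
    by apply: is_derive_eq; rewrite /GRing.scale/=; ring.
  move=> x0; have := @is_derive_le0_le v _ x dv.
  have v00 : v 0 = 0 by rewrite /v oppr0 mul0r subr0 subrr.
  rewrite v00; apply=> // y y0.
  by rewrite oppr_le0 mulr_ge0// subr_ge0 ler_expR; lra.
pose u x : R := (expR x + expR (- x)) * expR (- (x ^+ 2 / 2)).
have du (y : R) : is_derive y 1 u (v y * expR (- (y ^+ 2 / 2))).
  by apply: is_derive_eq; rewrite /v /GRing.scale/=; field.
move=> a0; have := @is_derive_le0_le u _ a du.
have -> : u 0 = 2 by rewrite /u oppr0 expr0n/= mul0r oppr0 expR0 mulr1.
rewrite /u (expRN (a ^+ 2 / 2)) ler_pdivrMr ?expR_gt0//.
by apply=> // x x0; rewrite mulr_le0_ge0 ?v0 ?expR_ge0.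
Qed.

(** By convexity the exponential lies below its chord over [-a, a], which has slope sinh(a)/a and
    value cosh(a) at 0; [cosh_le_expR_sqr] bounds that value. *)
Lemma expR_le_affine a : 0 <= a ->
  exists s, forall x, `|x| <= a -> expR x <= expR (a ^+ 2 / 2) + s * x.
Proof.
rewrite le_eqVlt => /predU1P[<-|a0].
  exists 0 => x; rewrite normr_le0 => /eqP ->.
  by rewrite expr0n/= mul0r mulr0 addr0.
exists ((expR a - expR (- a)) / (2 * a)) => x; rewrite ler_norml => /andP[ax xa].
have C := @cosh_le_expR_sqr a (ltW a0).
(* Convexity through the tangent at [x], evaluated at [a] and [- a] with weights [a + x] and
   [a - x]; the first-order terms cancel in the weighted sum. *)
have tg y : expR x * (1 + (y - x)) <= expR y.
  by rewrite -[y in leRHS](subrKC x) expRD ler_pM2l ?expR_gt0// expR_ge1Dx.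
have t1 : (a + x) * (expR x * (1 + (a - x))) <= (a + x) * expR a.
  by rewrite ler_wpM2l//; lra.
have t2 : (a - x) * (expR x * (1 + (- a - x))) <= (a - x) * expR (- a).
  by rewrite ler_wpM2l//; lra.
have a2 : 0 < 2 * a by lra.
rewrite -(ler_pM2l a2) mulrDr.
have -> : 2 * a * ((expR a - expR (- a)) / (2 * a) * x) = (expR a - expR (- a)) * x.
  by field; rewrite gt_eqF.
nra.
Qed.

End exp_inequalities.

(** * Exponential moments across one bounded increment *)

Section exponential_moments.
Context {d : measure_display} {T : measurableType d} {R : realType}.
Variable P : probability T R.
Implicit Types X Y D : T -> R.

(** Replacing [g] by [f \max g], which equals it almost everywhere, makes the inequality hold
    pointwise. *)
Lemma ae_integral_le (f g : T -> R) :
  measurable_fun setT f -> measurable_fun setT g -> (forall w, 0 <= f w) ->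
  {ae P, forall w, f w <= g w} ->
  (\int[P]_w (f w)%:E <= \int[P]_w (g w)%:E)%E.
Proof.
move=> mf mg f0 fg.
have mfg : measurable_fun setT (f \max g) by exact: measurable_maxr.
rewrite [leRHS](_ : _ = \int[P]_w ((f \max g) w)%:E)%E; last first.
  apply: ae_eq_integral => //; [exact/measurable_EFinP..|].
  by apply: filterS fg => w fgw _ /=; rewrite max_r.
apply: ge0_le_integral => //.
- by move=> w _; rewrite lee_fin.
- exact/measurable_EFinP.
- exact/measurable_EFinP.
- by move=> w _; rewrite lee_fin le_max lexx.
Qed.

Lemma ae_le_integrable (f g : T -> R) :
  measurable_fun setT f -> {ae P, forall w, `|f w| <= g w} ->
  P.-integrable setT (EFin \o g) -> P.-integrable setT (EFin \o f).
Proof.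
move=> mf fg /integrableP[/measurable_EFinP mg g_lty].
apply/integrableP; split; first exact/measurable_EFinP.
apply: le_lt_trans g_lty.
apply: (@ae_integral_le (Num.norm \o f) (Num.norm \o g)); [exact: measurableT_comp..| |].
- by move=> w /=; exact: normr_ge0.
- by apply: filterS fg => w /= /le_trans; apply; exact: ler_norm.
Qed.

Import HBSimple HBNNSimple.

(** Taking out what is known, for a difference [D] with zero conditional mean given [X]: [h] is
    approximated by simple functions, then dominated convergence applies. *)
Lemma integral_comp_mul_eq0 X D (h : R -> R) :
  measurable_fun setT X -> measurable_fun setT h -> (forall x, 0 <= h x) ->
  P.-integrable setT (EFin \o D) ->
  P.-integrable setT (EFin \o (fun w => h (X w) * D w)) ->
  (forall B, measurable B -> \int[P]_(w in X @^-1` B) (D w)%:E = 0)%E ->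
  (\int[P]_w (h (X w) * D w)%:E = 0)%E.
Proof.
move=> mX mh h0 iD ihD D0.
have mD : measurable_fun setT D by case/integrableP : iD => /measurable_EFinP.
have meh : measurable_fun setT (EFin \o h) by exact/measurable_EFinP.
pose g := nnsfun_approx measurableT meh.
have g0 n : (\int[P]_w (g n (X w) * D w)%:E = 0)%E.
  (* [g n] takes finitely many values, so the integral is a combination of integrals of [D] over
     preimages under [X]. *)
  pose s := fset_set (range (g n)).
  have -> : (\int[P]_w (g n (X w) * D w)%:E =
    \int[P]_w \sum_(i < #|` s|)
      (s`_i)%:E * ((EFin \o D) \_ (X @^-1` (g n @^-1` [set s`_i]))) w)%E.
    apply: eq_integral => w _.
    rewrite (fimfunEord (g n)) mulr_suml -sumEFin; apply: eq_bigr => i _.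
    rewrite -mulrA EFinM patchE indicE; congr (_ * _)%E.
    have -> : (w \in X @^-1` (g n @^-1` [set s`_i])) =
        (X w \in g n @^-1` [set s`_i]) by apply/idP/idP => /set_mem ?; apply/mem_set.
    by case: ifPn => _; rewrite ?mul1r ?mul0r.
  have mA i : measurable (X @^-1` (g n @^-1` [set s`_i])).
    by rewrite -[X in measurable X]setTI; exact: mX.
  have iA i : P.-integrable setT ((EFin \o D) \_ (X @^-1` (g n @^-1` [set s`_i]))).
    rewrite -integrable_mkcond//; exact: (integrableS measurableT _ (@subsetT _ _) iD).
  rewrite integral_sum//; last by move=> i; exact: integrableZl.
  apply: big1 => i _; rewrite integralZl//.
  by rewrite -integral_mkcond D0 ?mule0.
have gh n x : g n x <= h x.
  by rewrite -lee_fin /g nnsfun_approxE le_approx// => y _; rewrite lee_fin.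
(* Since [0 <= g n <= h], the absolute value of the limit dominates. *)
have [] := @dominated_convergence _ _ R P setT measurableT
  (fun n w => (g n (X w) * D w)%:E) (fun w => (h (X w) * D w)%:E)
  (fun w => `|h (X w) * D w|%:E).
- move=> n; apply/measurable_EFinP/measurable_funM => //.
  exact: measurableT_comp.
- by case/integrableP : ihD.
- apply: aeW => w _.
  have /fine_cvgP[_] : EFin \o g^~ (X w) @ \oo --> (EFin \o h) (X w).
    by apply: cvg_nnsfun_approx => // x _; rewrite lee_fin.
  move=> gc; apply/cvg_EFin; first by apply: nearW.
  exact: (cvgMr_tmp gc).
- exact: (integrable_abse ihD).
- apply: aeW => w n _; rewrite lee_fin !normrM ler_wpM2r// !ger0_norm//.
move=> _ _; rewrite (_ : [sequence _]_n = cst 0%E); last first.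
  by apply/funext => n /=; exact: g0.
by move/cvg_lim => <-//; rewrite lim_cst.
Qed.

Lemma measurable_expR_scale X l : measurable_fun setT X ->
  measurable_fun setT (fun w => expR (l * X w)).
Proof.
by move=> mX; apply: measurableT_comp => //; exact: measurable_funM.
Qed.

Lemma integrable_expR X l : measurable_fun setT X ->
  (\int[P]_w (expR (l * X w))%:E < +oo)%E ->
  P.-integrable setT (EFin \o (fun w => expR (l * X w))).
Proof.
move=> mX fin; apply/integrableP; split.
  exact/measurable_EFinP/measurable_expR_scale.
by under eq_integral do rewrite /= ger0_norm ?expR_ge0//.
Qed.

(** Almost surely [l * Y] exceeds [l * X] by at most [|l| * e]. This yields the linear bound, and
    finiteness of the next exponential moment. *)
Lemma mgf_bounded_increment X Y (e l : R) :
  measurable_fun setT X -> measurable_fun setT Y ->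
  {ae P, forall w, `|Y w - X w| <= e} ->
  (\int[P]_w (expR (l * Y w))%:E <=
   (expR (`|l| * e))%:E * \int[P]_w (expR (l * X w))%:E)%E.
Proof.
move=> mX mY YX; rewrite -ge0_integralZl//; last first.
  exact/measurable_EFinP/measurable_expR_scale.
under [leRHS]eq_integral do rewrite -EFinM.
apply: ae_integral_le; [exact: measurable_expR_scale| |by move=> w; exact: expR_ge0|].
  by apply: measurable_funM => //; exact: measurable_expR_scale.
apply: filterS YX => w YX; rewrite -expRD ler_expR -lerBlDr -mulrBr.
by rewrite (le_trans (ler_norm _))// normrM ler_wpM2l.
Qed.

(* Hoeffding's argument: bound [expR (l (Y - X))] by the affine majorant of the
   exponential on [[- `|l| e, `|l| e]]; the linear part integrates to 0 against
   [expR (l X)] because X is a version of E[Y | X]. *)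
Lemma mgf_martingale_increment X Y (e l : R) :
  P.-integrable setT (EFin \o X) -> P.-integrable setT (EFin \o Y) ->
  (forall B, measurable B ->
    \int[P]_(w in X @^-1` B) (X w)%:E = \int[P]_(w in X @^-1` B) (Y w)%:E)%E ->
  0 <= e -> {ae P, forall w, `|Y w - X w| <= e} ->
  (\int[P]_w (expR (l * X w))%:E < +oo)%E ->
  (\int[P]_w (expR (l * Y w))%:E <=
   (expR (l ^+ 2 * e ^+ 2 / 2))%:E * \int[P]_w (expR (l * X w))%:E)%E.
Proof.
move=> iX iY XY e0 YX fin.
have mX : measurable_fun setT X by case/integrableP : iX => /measurable_EFinP.
have mY : measurable_fun setT Y by case/integrableP : iY => /measurable_EFinP.
have mE := @measurable_expR_scale X l mX.
have iE := @integrable_expR X l mX fin.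
have iD : P.-integrable setT (EFin \o (fun w => Y w - X w)).
  exact: (@integrableB _ _ _ P _ measurableT _ _ iY iX).
have iED : P.-integrable setT (EFin \o (fun w => expR (l * X w) * (Y w - X w))).
  apply: (@ae_le_integrable _ (fun w => e * expR (l * X w))).
  - by apply: measurable_funM => //; exact: measurable_funB.
  - apply: filterS YX => w; rewrite normrM (ger0_norm (expR_ge0 _)) mulrC => h.
    by rewrite ler_wpM2r// expR_ge0.
  - exact: (@integrableZl _ _ _ P _ measurableT e _ iE).
have ED0 : (\int[P]_w (expR (l * X w) * (Y w - X w))%:E = 0)%E.
  apply: (@integral_comp_mul_eq0 X _ (fun x => expR (l * x))) => //.
  - exact: (@measurableT_comp _ _ _ _ _ _ expR).
  - move=> B mB; have mXB : measurable (X @^-1` B).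
      by rewrite -[X in measurable X]setTI; exact: mX.
    under eq_integral do rewrite EFinB.
    have iXB := @integrableS _ _ _ P _ _ _ measurableT mXB (@subsetT _ _) iX.
    have iYB := @integrableS _ _ _ P _ _ _ measurableT mXB (@subsetT _ _) iY.
    rewrite (@integralB _ _ _ P _ mXB _ _ iYB iXB)/= -XY// subee//.
    exact: integrable_fin_num.
have [s hs] := @expR_le_affine R (`|l| * e) (mulr_ge0 (normr_ge0 _) e0).
set K := expR (l ^+ 2 * e ^+ 2 / 2).
have hK : expR ((`|l| * e) ^+ 2 / 2) = K by rewrite exprMn real_normK ?num_real.
rewrite hK in hs.
apply: (@le_trans _ _ (\int[P]_w (K * expR (l * X w) +
    (s * l) * (expR (l * X w) * (Y w - X w)))%:E)%E).
  apply: ae_integral_le.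
  - exact: measurable_expR_scale.
  - apply: measurable_funD; apply: measurable_funM => //.
    by apply: measurable_funM => //; exact: measurable_funB.
  - by move=> w; exact: expR_ge0.
  - apply: filterS YX => w YX.
    have -> : l * Y w = l * X w + l * (Y w - X w) by ring.
    have -> : K * expR (l * X w) + s * l * (expR (l * X w) * (Y w - X w)) =
      expR (l * X w) * (K + s * (l * (Y w - X w))) by ring.
    rewrite expRD ler_pM2l ?expR_gt0//; apply: hs.
    by rewrite normrM ler_wpM2l.
have i1 := @integrableZl _ _ _ P _ measurableT K _ iE.
have i2 := @integrableZl _ _ _ P _ measurableT (s * l) _ iED.
under eq_integral do rewrite EFinD !(EFinM K) !(EFinM (s * l)).
rewrite (@integralD _ _ _ P _ measurableT _ _ i1 i2).
rewrite (@integralZl _ _ _ P _ measurableT _ iE).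
by rewrite (@integralZl _ _ _ P _ measurableT _ iED) ED0 mule0 adde0.
Qed.

End exponential_moments.

(** * From exponential moments to the tail bound *)

Section martingale_concentration.
Context {d : measure_display} {T : measurableType d} {R : realType}.
Variable P : probability T R.

(** The infimum [tau] is not known to be attained, so the bound is first obtained for every c' > c
    and then passed to the limit by continuity of [phi]. *)
Lemma mgf_le_of_tau (X : {RV P >-> R}) (s c l : R) : 0 < s -> 0 <= c ->
  (tau s X <= c%:E)%E ->
  (\int[P]_w (expR (l * X w))%:E <= (expR (phi s (c * l)))%:E)%E.
Proof.
move=> s0 c0 Xc.
have E : ('E_P[fun w => expR (l * X w)] = \int[P]_w (expR (l * X w))%:E)%E.
  by rewrite unlock.
set M := (\int[P]_w _)%E in E *.
have M0 : (0 <= M)%E by apply: integral_ge0 => w _; rewrite lee_fin expR_ge0.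
have h c' : c < c' -> (M <= (expR (phi s (c' * l)))%:E)%E.
  move=> cc'; have /ereal_inf_lt[_ [b [b0 hb] <-]] : (tau s X < c'%:E)%E.
    by apply: le_lt_trans Xc _; rewrite lte_fin.
  rewrite lte_fin => bc'; have := hb l; rewrite E -lee_expeR lneK; last first.
    by rewrite in_itv/= M0 leey.
  move=> /le_trans; apply; rewrite lee_fin ler_expR phi_nondecreasing// !normrM.
  by rewrite ler_wpM2r// !ger0_norm// ltW// (le_lt_trans b0).
(* Finiteness, from the bound at [c + 1], turns the inequality into one between reals before the
   limit is taken. *)
have : M \is a fin_num.
  rewrite ge0_fin_numE//; apply: le_lt_trans (h (c + 1) _) _; last exact: ltry.
  by rewrite ltrDl.
move/fineK => <-; rewrite lee_fin.
have cv : expR (phi s (c' * l)) @[c' --> c^'+] --> expR (phi s (c * l)).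
  apply: cvg_at_right_filter.
  apply: (@continuous_comp _ _ _ (fun x : R => phi s (x * l)) expR).
    apply: (@continuous_comp _ _ _ (fun x : R => x * l) (phi s)).
      exact: mulrr_continuous.
    exact: continuous_phi.
  exact: continuous_expR.
apply: (@cvgr_to_ge _ _ _ _ _ _ _ cv); near=> c'.
rewrite -lee_fin fineK; first by apply: h; near: c'; exact: nbhs_right_gt.
rewrite ge0_fin_numE//; apply: le_lt_trans (h (c + 1) _) _; last exact: ltry.
by rewrite ltrDl.
Unshelve. all: by end_near. Qed.

(** Each one-step bound is iterated separately and the minimum is taken only at the end. The linear
    bound comes first: it propagates the finiteness that the quadratic one requires. *)
Lemma mgf_martingale (F : nat -> set (set T)) (xi : nat -> {RV P >-> R})
    (dn : nat -> R) (l : R) n :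
  martingale F xi ->
  (forall k, 0 <= dn k) ->
  (forall k, {ae P, forall w, `|xi k.+1 w - xi k w| <= dn k.+1}) ->
  (\int[P]_w (expR (l * xi 0%N w))%:E < +oo)%E ->
  (\int[P]_w (expR (l * xi n w))%:E <=
   (expR (Num.min ((\sum_(1 <= i < n.+1) dn i ^+ 2) * `|l| ^+ 2 / 2)
                  ((\sum_(1 <= i < n.+1) dn i) * `|l|)))%:E *
   \int[P]_w (expR (l * xi 0%N w))%:E)%E.
Proof.
move=> [_ adapted int cexp] dn0 bd fin0.
pose M k := (\int[P]_w (expR (l * xi k w))%:E)%E.
have M0 k : (0 <= M k)%E by apply: integral_ge0 => w _; rewrite lee_fin expR_ge0.
have lin k : (M k.+1 <= (expR (`|l| * dn k.+1))%:E * M k)%E.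
  exact: mgf_bounded_increment.
have fin k : (M k < +oo)%E.
  elim: k => [//|k ih]; apply: le_lt_trans (lin k) _.
  by rewrite lte_mul_pinfty ?lee_fin ?expR_ge0.
have sqr k : (M k.+1 <= (expR (l ^+ 2 * dn k.+1 ^+ 2 / 2))%:E * M k)%E.
  apply: mgf_martingale_increment => //; last exact: fin.
  move=> B mB; have [_ _ h] := cexp k; apply: h; apply: adapted.
  by exists B => //; rewrite setTI.
have iter (f : nat -> R) :
    (forall k, (M k.+1 <= (expR (f k.+1))%:E * M k)%E) ->
    (M n <= (expR (\sum_(1 <= i < n.+1) f i))%:E * M 0%N)%E.
  move=> hf; elim: n => [|k ih]; first by rewrite big_nil expR0 mul1e.
  apply: le_trans (hf k) _; rewrite big_nat_recr//= expRD EFinM.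
  rewrite [((_ * (expR (f k.+1))%:E))%E]muleC -muleA.
  by rewrite lee_wpmul2l// lee_fin expR_ge0.
rewrite -/(M n) -/(M 0%N) minEle; case: ifPn => _.
  rewrite [X in expR X](_ : _ = \sum_(1 <= i < n.+1) l ^+ 2 * dn i ^+ 2 / 2).
    exact: (iter (fun i => l ^+ 2 * dn i ^+ 2 / 2)).
  rewrite real_normK ?num_real// -mulrA mulr_suml.
  by apply: eq_bigr => i _; rewrite mulrA [l ^+ 2 * _]mulrC.
rewrite [X in expR X](_ : _ = \sum_(1 <= i < n.+1) `|l| * dn i).
  exact: (iter (fun i => `|l| * dn i)).
by rewrite mulr_suml; apply: eq_bigr => i _; rewrite mulrC.
Qed.

(** Chernoff's bound for [X] and for [- X], then a union bound; both moments are controlled alike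
    because [phi] is even. *)
Lemma chernoff_phi (X : {RV P >-> R}) (p q c eps : R) :
  1 < p -> p^-1 + q^-1 = 1 -> 0 < c -> 0 < eps ->
  (forall l, \int[P]_w (expR (l * X w))%:E <= (expR (phi p (c * l)))%:E)%E ->
  (P [set w | (eps <= `|X w|)%R] <= (2 * expR (- phi q (eps / c)))%:E)%E.
Proof.
move=> p1 pq c0 e0 mgf.
have mX : measurable_fun setT X by [].
(* With Chernoff parameter t/c the exponent is phi_p(t) - t (eps/c), which the choice of [t] makes
   equal to -phi_q(eps/c). *)
have [t t0 tE] := @phi_conj R p q (eps / c) p1 pq (divr_gt0 e0 c0).
have l0 : 0 < t / c by rewrite divr_gt0.
have side (Y : T -> R) : measurable_fun setT Y ->
    (\int[P]_w (expR (t / c * Y w))%:E <= (expR (phi p t))%:E)%E ->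
    (P [set w | (eps <= Y w)%R] <= (expR (- phi q (eps / c)))%:E)%E.
  move=> mY hY.
  pose Y' : {RV P >-> R} := HB.pack Y (isMeasurableFun.Build _ _ _ _ Y mY).
  apply: le_trans (@chernoff _ _ _ P Y' (t / c) eps l0) _.
  rewrite /mmt_gen_fun unlock -tE expRD.
  have -> : - (t * (eps / c)) = - (t / c * eps) by field; rewrite gt_eqF.
  rewrite EFinM lee_wpmul2r ?lee_fin ?expR_ge0//.
  by under eq_integral do rewrite /= mulrC.
have mNX : measurable_fun setT (fun w => - X w) by exact: measurableT_comp.
have hp := side X mX; have hm := side (fun w => - X w) mNX.
have ct : c * (t / c) = t by field; rewrite gt_eqF.
have -> : [set w | (eps <= `|X w|)%R] =
    [set w | (eps <= X w)%R] `|` [set w | (eps <= - X w)%R].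
  by apply/seteqP; split => w /=; rewrite ler_normr; [move/orP|move=> ?; apply/orP].
have mS (Y : T -> R) : measurable_fun setT Y -> measurable [set w | (eps <= Y w)%R].
  move=> mY; rewrite [X in measurable X](_ : _ = setT `&` Y @^-1` `[eps, +oo[%classic).
    exact: mY.
  by apply/seteqP; split => w /=; rewrite in_itv/= andbT => // -[].
apply: le_trans (measureU2 _ (mS _ mX) (mS _ mNX)) _.
rewrite mulr_natl mulr2n EFinD leeD//.
- by apply: hp; rewrite -{2}ct.
- apply: hm; under eq_integral do rewrite mulrN -mulNr.
  by apply: le_trans (mgf _) _; rewrite mulrN ct -phi_norm normrN phi_norm.
Qed.

End martingale_concentration.

Theorem theorem3p3 (disp : measure_display) (T : measurableType disp)
    (R : realType) (P : probability T R) (p q : R)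
    (xi : nat -> {RV P >-> R}) (dn : nat -> R) (n : nat) :
  1 < p ->
  p^-1 + q^-1 = 1 ->
  martingale (natural_filtration (fun k => xi k : T -> R)) xi ->
  (forall k, 0 <= dn k) ->
  Sub_phi p (xi 0%N) ->
  (tau p (xi 0%N) <= (dn 0%N)%:E)%E ->
  (forall k, {ae P, forall w, `|xi k.+1 w - xi k w| <= dn k.+1}) ->
  (1 <= n)%N ->
  (exists i, (1 <= i <= n)%N /\ dn i <> 0) ->
  let r := Num.min p 2 in
  let c := Num.sqrt (\sum_(1 <= i < n.+1) dn i ^+ 2) in
  let d := \sum_(1 <= i < n.+1) dn i in
  let gamma :=
    c ^+ 2 / (2 * d) * (r * (2 * (d / c) ^+ 2 + r^-1 - 2^-1)) `^ r^-1 in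
  forall eps : R, 0 < eps ->
    (P [set w | (eps <= `|xi n w|)%R] <=
     (2 * expR (- phi q (eps / (gamma `^ r + dn 0%N `^ r) `^ r^-1)))%:E)%E.
Proof.
move=> p1 pq mart dn0 _ tau0 bd _ [j [jn dj]] r c d g eps eps0.
have r1 : 1 < r by rewrite lt_min p1/= ltr1n.
have r2 : r <= 2 by rewrite ge_min lexx orbT.
have r0 : 0 < r by lra.
have djp : 0 < dn j by rewrite lt0r dn0 andbT; apply/eqP.
have jin : j \in index_iota 1 n.+1 by rewrite mem_index_iota ltnS.
pose C := \sum_(1 <= i < n.+1) dn i ^+ 2.
have C0 : 0 < C.
  rewrite /C (bigD1_seq j)//= ?iota_uniq// ltr_wpDr ?exprn_gt0//.
  by apply: sumr_ge0 => i _; rewrite sqr_ge0.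
have d0 : 0 < d.
  by rewrite /d (bigD1_seq j)//= ?iota_uniq// ltr_wpDr// sumr_ge0.
have c2 : c ^+ 2 = C by rewrite sqr_sqrtr// ltW.
have c0 : 0 < c by rewrite sqrtr_gt0.
(* Each [dn i] in the sum is at most [d]. *)
have Cd : C <= d ^+ 2.
  rewrite expr2 {1}/d mulr_suml ler_sum_nat// => i ilt.
  rewrite expr2 ler_wpM2l// /d (bigD1_seq i)//= ?iota_uniq ?mem_index_iota//.
  by rewrite lerDl sumr_ge0.
have dc : (d / c) ^+ 2 = d ^+ 2 / C by rewrite expr_div_n c2.
have dC1 : 1 <= d ^+ 2 / C by rewrite ler_pdivlMr// mul1r.
have rV : 0 < r^-1 by rewrite invr_gt0.
set b := r * (2 * (d / c) ^+ 2 + r^-1 - 2^-1).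
(* Here b = 2 r d^2/C + 1 - r/2 with d^2/C >= 1. Thus b^(1/r) >= 1, and [phi r] is given there by
   its power branch. *)
have b1 : 1 <= b.
  rewrite /b dc mulrBr mulrDr divff ?gt_eqF//; nra.
have b0 : 0 < b by lra.
have g0 : 0 < g by rewrite mulr_gt0 ?powR_gt0// c2 divr_gt0// mulr_gt0.
have gE : g * (2 * d / C) = b `^ r^-1.
  by rewrite /g -/b c2; field; rewrite !gt_eqF.
(* Solving phi_r(y) = 2 d^2/C on the power branch gives y = b^(1/r), which explains the form of
   gamma. *)
have phig : phi r (g * (2 * d / C)) = 2 * d ^+ 2 / C.
  rewrite gE phi_ge1 ?gt_eqF//; last by rewrite powRs_ge1// ltW.
  rewrite -powRrM mulVf ?gt_eqF// powRr1 ?(ltW b0)// /b dc.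
  by field; rewrite !gt_eqF.
apply: (@chernoff_phi _ _ _ P (xi n) p q) => //.
  by rewrite powR_gt0// ltr_wpDr ?powR_ge0// powR_gt0.
move=> l.
have m0 := @mgf_le_of_tau _ _ _ P (xi 0%N) p (dn 0%N) l
  (lt_trans ltr01 p1) (dn0 _) tau0.
have fin0 : (\int[P]_w (expR (l * xi 0%N w))%:E < +oo)%E.
  by apply: le_lt_trans m0 _; exact: ltry.
apply: le_trans (@mgf_martingale _ _ _ P _ xi dn l n mart dn0 bd fin0) _.
rewrite -/C -/d.
apply: (@le_trans _ _ ((expR (phi r (g * `|l|)))%:E *
                       (expR (phi p (dn 0%N * l)))%:E)%E).
  apply: lee_pmul => //.
  - by apply: integral_ge0 => w _; rewrite lee_fin expR_ge0.
  - by rewrite lee_fin ler_expR min_sqr_lin_le_phi.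
rewrite -EFinM -expRD lee_fin ler_expR.
(* Either [r = p], or [p] is at least 2 and [r = 2]. *)
have rp x : phi r x <= phi p x.
  rewrite /r; have [//|/ltW p2] := leP p 2; exact: phi2_le.
apply: le_trans (lerD (rp _) (lexx _)) _.
rewrite -(phi_norm p (dn 0%N * l)) normrM (ger0_norm (dn0 _)).
have gl : 0 <= g * `|l| by rewrite mulr_ge0// ltW.
have dl : 0 <= dn 0%N * `|l| by rewrite mulr_ge0.
apply: le_trans (phi_superadditive _ _ _ p1 gl dl) _.
(* What remains is homogeneity: [|l|] factors out of the [r]-th root of the sum of [r]-th powers. *)
rewrite -/r -[leRHS]phi_norm normrM (ger0_norm (powR_ge0 _ _)).
rewrite (powRM _ (ltW g0))// (powRM _ (dn0 _))// -mulrDl powRM ?powR_ge0//; last first.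
  by rewrite addr_ge0 ?powR_ge0.
by rewrite -powRrM divff ?gt_eqF// powRr1.
Qed.
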